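(* Let $M_1,M_2$ be monoids with a common submonoid $W$, let $L=M_1\ast_W M_2$ be the amalgamated free product, and suppose that $\mathbb ZL$ is flat as a right $\mathbb ZM_1$-module, as a right $\mathbb ZM_2$-module and as a right $\mathbb ZW$-module. Let $1\le n\le\infty$. If $M_1,M_2$ are of type left-$\mathrm{FP}_n$ and $W$ is of type left-$\mathrm{FP}_{n-1}$, then $M_1\ast_W M_2$ is of type left-$\mathrm{FP}_n$.
   Context: Convention: $\infty-1=\infty$. $M_1\ast_W M_2$ is the pushout, in the category of monoids, of the inclusions $W\to M_1$ and $W\to M_2$; $\mathbb ZL$ is a right module over $\mathbb ZM_1$, $\mathbb ZM_2$, $\mathbb ZW$ via the canonical homomorphisms to $L$ (which need not be injective) and right multiplication. A monoid $M$ is of type left-$\mathrm{FP}_n$ ($0\le n\le \infty$) if the trivial left $\mathbb ZM$-module $\mathbb Z$ has a projective resolution $(P_i)_{i\ge0}$ with $P_i$ finitely generated for all $i\leq n$ (for all $i$ if $n=\infty$). *)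

(* Defs.v *)
From HB Require Import structures.
From mathcomp Require Import all_boot all_algebra finmap.
From mathcomp Require Import boolp.
From mathcomp Require Import monalg.

Set Implicit Arguments.
Unset Strict Implicit.
Unset Printing Implicit Defensive.

Import GRing.Theory.
Local Open Scope ring_scope.

Notation "{ 'monhom' M -> N }" := (UMagmaMorphism.type M N)
  (M at level 98, N at level 99) : type_scope.

(* {malg int[K]} is the free abelian group on K, and zlift f the additive map
   that extends f. *)
Definition zlift (K : choiceType) (V : zmodType) (f : K -> V)
    (x : {malg int[K]}) : V :=
  \sum_(k <- msupp x) f k *~ x@_k.

Section ZLift.
Variables (K : choiceType) (V : zmodType) (f : K -> V).

Lemma zliftEw (x : {malg int[K]}) (d : {fset K}) :
  (msupp x `<=` d)%fset -> zlift f x = \sum_(k <- d) f k *~ x@_k.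
Proof.
move=> le_xd; apply: big_fset_incl => // k _ /mcoeff_outdom ->.
by rewrite mulr0z.
Qed.

Lemma zlift_is_zmod_morphism : zmod_morphism (zlift f).
Proof.
move=> x y; rewrite (zliftEw (msuppB_le x y)).
rewrite (zliftEw (fsubsetUl _ (msupp y))) (zliftEw (fsubsetUr (msupp x) _)).
rewrite -sumrB; apply: eq_bigr => k _.
by rewrite mcoeffB mulrzBr.
Qed.

HB.instance Definition _ := GRing.isZmodMorphism.Build {malg int[K]} V (zlift f)
  zlift_is_zmod_morphism.

Lemma zliftU c k : zlift f << c *g k >> = f k *~ c.
Proof. by rewrite (zliftEw msuppU_le) big_seq_fset1 mcoeffUU. Qed.

End ZLift.

Lemma malgZU (K : choiceType) c (k : K) :
  << c *g k >> = << k >> *~ c :> {malg int[K]}.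
Proof. by rewrite -raddfMz intz. Qed.

Lemma zlift_uniq (K : choiceType) (V : zmodType)
    (g h : {additive {malg int[K]} -> V}) :
  (forall k, g << k >> = h << k >>) -> g =1 h.
Proof.
move=> gh x; rewrite (monalgE x) !raddf_sum; apply: eq_bigr => k _.
by rewrite malgZU !raddfMz gh.
Qed.

(* The monoid ring ZM; the ring {malg int[M]} of multinomials is only available
   for monoids in which x * y = 1 implies x = y = 1. *)
Definition monring (M : monoidType) : Type := {malg int[M]}.

HB.instance Definition _ (M : monoidType) := GRing.Zmodule.on (monring M).

Section MonRing.
Variable M : monoidType.
Implicit Types x y z : monring M.

Definition mring (m : M) : monring M := << m >>.

Definition monring_mul x y : monring M :=
  zlift (fun a : M => zlift (fun b : M => mring (a * b)%g) y) x.

Lemma monring_ext (V : zmodType) (g h : monring M -> V) :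
    zmod_morphism g -> zmod_morphism h ->
  (forall m, g (mring m) = h (mring m)) -> g =1 h.
Proof.
move=> gB hB; pose gM := GRing.isZmodMorphism.Build (monring M) V g gB.
pose hM := GRing.isZmodMorphism.Build (monring M) V h hB.
pose ga : {additive monring M -> V} := HB.pack g gM.
pose ha : {additive monring M -> V} := HB.pack h hM.
exact: (zlift_uniq (g := ga) (h := ha)).
Qed.

Lemma zlift_mring (V : zmodType) (f : M -> V) m : zlift f (mring m) = f m.
Proof. by rewrite zliftU mulr1z. Qed.

Fact monring_mulBl z : zmod_morphism (monring_mul^~ z).
Proof. by move=> x y; apply: raddfB. Qed.

Fact monring_mulBr z : zmod_morphism (monring_mul z).
Proof.
move=> x y; rewrite /monring_mul /(zlift _ z) -sumrB; apply: eq_bigr => a _.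
by rewrite -mulrzBl -raddfB.
Qed.

Fact monring_mulDl : left_distributive monring_mul +%R.
Proof. by move=> x y z; apply: raddfD. Qed.

Fact monring_mulDr : right_distributive monring_mul +%R.
Proof.
by move=> z x y; apply/eqP; rewrite -subr_eq -monring_mulBr addrK.
Qed.

Fact monring_mulUU a b : monring_mul (mring a) (mring b) = mring (a * b)%g.
Proof. by rewrite /monring_mul !zlift_mring. Qed.

Fact monring_mulA : associative monring_mul.
Proof.
move=> x y z.
apply: (monring_ext (g := fun x => monring_mul x (monring_mul y z))
                    (h := fun x => monring_mul (monring_mul x y) z)) => [||a].
- by move=> u v; rewrite monring_mulBl.
- by move=> u v; rewrite !monring_mulBl.
apply: (monring_ext (g := fun y => monring_mul _ (monring_mul y z))
                    (h := fun y => monring_mul (monring_mul _ y) z)) => [||b].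
- by move=> u v; rewrite monring_mulBl monring_mulBr.
- by move=> u v; rewrite monring_mulBr monring_mulBl.
apply: (monring_ext (g := fun z => monring_mul _ (monring_mul _ z))) => [||c].
- by move=> u v; rewrite !monring_mulBr.
- exact: monring_mulBr.
by rewrite !monring_mulUU mulgA.
Qed.

Fact monring_mul1r : left_id (mring 1%g) monring_mul.
Proof.
apply: monring_ext => [||a]; [exact: monring_mulBr | by [] |].
by rewrite monring_mulUU mul1g.
Qed.

Fact monring_mulr1 : right_id (mring 1%g) monring_mul.
Proof.
apply: monring_ext => [||a]; [exact: monring_mulBl | by [] |].
by rewrite monring_mulUU mulg1.
Qed.

Fact monring_1neq0 : mring 1%g != 0.
Proof. by rewrite monalgU_eq0 oner_eq0. Qed.

HB.instance Definition _ := GRing.Zmodule_isNzRing.Build (monring M)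
  monring_mulA monring_mul1r monring_mulr1 monring_mulDl monring_mulDr
  monring_1neq0.

Lemma mring1 : mring 1%g = 1. Proof. by []. Qed.
Lemma mringM a b : mring (a * b)%g = mring a * mring b.
Proof. by rewrite -monring_mulUU. Qed.

End MonRing.

Definition augmentation (M : monoidType) : monring M -> int :=
  zlift (fun=> 1 : int).

Definition monring_map (M N : monoidType) (f : {monhom M -> N}) :
    monring M -> monring N :=
  zlift (fun m => mring (f m)).

Section MonRingMorphisms.

Fact zlift_monoid_morphism (M : monoidType) (S : nzRingType) (f : M -> S) :
  f 1%g = 1 -> (forall a b, f (a * b)%g = f a * f b) ->
  monoid_morphism (zlift f : monring M -> S).
Proof.
move=> f1 fM; split=> [|x y]; first by rewrite -mring1 zlift_mring.
have zB := raddfB (zlift f : {additive monring M -> S}).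
apply: (monring_ext (g := fun x => zlift f (x * y))
                    (h := fun x => zlift f x * zlift f y)) => [||a].
- by move=> u v; rewrite mulrBl zB.
- by move=> u v; rewrite zB mulrBl.
apply: (monring_ext (g := fun y => zlift f (_ * y))
                    (h := fun y => zlift f _ * zlift f y)) => [||b].
- by move=> u v; rewrite mulrBr zB.
- by move=> u v; rewrite zB mulrBr.
by rewrite -mringM !zlift_mring fM.
Qed.

Variables (M N : monoidType) (f : {monhom M -> N}).

HB.instance Definition _ := GRing.Additive.copy (@augmentation M)
  (zlift (fun=> 1 : int) : {malg int[M]} -> int).
HB.instance Definition _ := GRing.isMonoidMorphism.Build (monring M) int
  (@augmentation M)
  (zlift_monoid_morphism (erefl : (fun=> 1 : int) (1%g : M) = 1)
     (fun _ _ => erefl)).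

Fact monring_map_monoid_morphism : monoid_morphism (monring_map f).
Proof.
by apply: zlift_monoid_morphism => [|a b]; rewrite ?gmulf1 ?gmulfM ?mringM.
Qed.

HB.instance Definition _ := GRing.Additive.copy (monring_map f)
  (zlift (fun m => mring (f m)) : {malg int[M]} -> monring N).
HB.instance Definition _ := GRing.isMonoidMorphism.Build (monring M) (monring N)
  (monring_map f) monring_map_monoid_morphism.

End MonRingMorphisms.

(* Given a ring homomorphism phi : R -> S, S as a left R-module for
   a . x = phi a * x, and as a right R-module for x . a = x * phi a.  Right
   R-modules are left modules over the opposite ring R^c. *)
Definition lres (R S : pzRingType) (phi : {rmorphism R -> S}) : Type := S.
Definition rres (R S : pzRingType) (phi : {rmorphism R -> S}) : Type := S.

Section Restriction.
Variables (R S : pzRingType) (phi : {rmorphism R -> S}).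

HB.instance Definition _ := GRing.Zmodule.on (lres phi).
HB.instance Definition _ := GRing.Zmodule.on (rres phi).

Definition lres_scale (a : R) (x : lres phi) : lres phi := phi a * (x : S).
Definition rres_scale (a : R^c) (x : rres phi) : rres phi := (x : S) * phi a.

Fact lres_scaleA a b x : lres_scale a (lres_scale b x) = lres_scale (a * b) x.
Proof. by rewrite /lres_scale rmorphM mulrA. Qed.
Fact lres_scale1 : left_id 1 lres_scale.
Proof. by move=> x; rewrite /lres_scale rmorph1 mul1r. Qed.
Fact lres_scaleDr : right_distributive lres_scale +%R.
Proof. by move=> a x y; rewrite /lres_scale mulrDr. Qed.
Fact lres_scaleDl x : {morph lres_scale^~ x : a b / a + b}.
Proof. by move=> a b; rewrite /lres_scale rmorphD mulrDl. Qed.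

HB.instance Definition _ := GRing.Zmodule_isLmodule.Build R (lres phi)
  lres_scaleA lres_scale1 lres_scaleDr lres_scaleDl.

Fact rres_scaleA (a b : R^c) x :
  rres_scale a (rres_scale b x) = rres_scale (a * b) x.
Proof. by rewrite /rres_scale -mulrA -rmorphM. Qed.
Fact rres_scale1 : left_id 1 rres_scale.
Proof. by move=> x; rewrite /rres_scale rmorph1 mulr1. Qed.
Fact rres_scaleDr : right_distributive rres_scale +%R.
Proof. by move=> a x y; rewrite /rres_scale mulrDl. Qed.
Fact rres_scaleDl x : {morph rres_scale^~ x : a b / a + b}.
Proof. by move=> a b; rewrite /rres_scale rmorphD mulrDr. Qed.

HB.instance Definition _ := GRing.Zmodule_isLmodule.Build R^c (rres phi)
  rres_scaleA rres_scale1 rres_scaleDr rres_scaleDl.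

End Restriction.

Section Tensor.
Variables (R : pzRingType) (F : lmodType R^c) (A : lmodType R).

(* The subgroup of the free abelian group on F * A generated by the relations
   defining the tensor product; (a : R^c) *: x is x . a. *)
Inductive tensor_rel : {malg int[(F * A)%type]} -> Prop :=
| Tensor0 : tensor_rel 0
| TensorB u v : tensor_rel u -> tensor_rel v -> tensor_rel (u - v)
| TensorDl x y b :
    tensor_rel (<< (x + y, b) >> - << (x, b) >> - << (y, b) >>)
| TensorDr x b c :
    tensor_rel (<< (x, b + c) >> - << (x, b) >> - << (x, c) >>)
| TensorZ x (a : R) b :
    tensor_rel (<< ((a : R^c) *: x, b) >> - << (x, a *: b) >>).

Definition tensor_relb : {pred {malg int[(F * A)%type]}} :=
  fun u => `[< tensor_rel u >].

Fact tensor_rel_closed : zmod_closed tensor_relb.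
Proof.
split=> [|u v /asboolP ru /asboolP rv]; apply/asboolP; first exact: Tensor0.
exact: TensorB.
Qed.

HB.instance Definition _ :=
  GRing.isZmodClosed.Build {malg int[(F * A)%type]} tensor_relb
    tensor_rel_closed.

Definition tensor : zmodType := {ideal_quot tensor_relb}.

Definition tensor_pi (u : {malg int[(F * A)%type]}) : tensor :=
  (\pi_{ideal_quot tensor_relb} u)%qT.

HB.instance Definition _ := GRing.Additive.copy tensor_pi
  (\pi_{ideal_quot tensor_relb})%qT.

Definition tens (x : F) (b : A) : tensor := tensor_pi << (x, b) >>.

Lemma tensor_piP u : tensor_pi u = 0 <-> tensor_rel u.
Proof.
rewrite -(raddf0 tensor_pi); split=> [/eqP|ru].
  by rewrite -Quotient.idealrBE subr0 => /asboolP.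
by apply/eqP; rewrite -Quotient.idealrBE subr0; apply/asboolP.
Qed.

Lemma tensor_pi_surj t : exists u, t = tensor_pi u.
Proof. by exists (repr t); rewrite /tensor_pi reprK. Qed.

Lemma tensDl x y b : tens (x + y) b = tens x b + tens y b.
Proof.
apply/eqP; rewrite -subr_eq0 opprD addrA -!raddfB.
exact/eqP/tensor_piP/TensorDl.
Qed.

Lemma tensDr x b c : tens x (b + c) = tens x b + tens x c.
Proof.
apply/eqP; rewrite -subr_eq0 opprD addrA -!raddfB.
exact/eqP/tensor_piP/TensorDr.
Qed.

Lemma tensZ x (a : R) b : tens ((a : R^c) *: x) b = tens x (a *: b).
Proof.
by apply/eqP; rewrite -subr_eq0 -raddfB; apply/eqP/tensor_piP/TensorZ.
Qed.

Section UniversalProperty.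
Variables (V : zmodType) (beta : F -> A -> V).
Hypotheses (betaDl : forall x y b, beta (x + y) b = beta x b + beta y b)
  (betaDr : forall x b c, beta x (b + c) = beta x b + beta x c)
  (betaZ : forall x (a : R) b, beta ((a : R^c) *: x) b = beta x (a *: b)).

Lemma tensor_rel_balanced u :
  tensor_rel u -> zlift (fun p => beta p.1 p.2) u = 0.
Proof.
elim=> [|v w _ v0 _ w0|x y b|x b c|x a b]; rewrite ?raddf0 ?raddfB //=.
- by rewrite v0 w0 subr0.
- by rewrite !zliftU !mulr1z betaDl -addrA -opprD subrr.
- by rewrite !zliftU !mulr1z betaDr -addrA -opprD subrr.
- by rewrite !zliftU !mulr1z betaZ subrr.
Qed.

Lemma tensor_universal :
  exists g : {additive tensor -> V}, forall x b, g (tens x b) = beta x b.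
Proof.
pose l := zlift (fun p : F * A => beta p.1 p.2).
pose g (t : tensor) := l (repr t).
have gE u : g (tensor_pi u) = l u.
  apply/eqP; rewrite -subr_eq0 -raddfB.
  apply/eqP/tensor_rel_balanced/tensor_piP.
  by rewrite raddfB /= /tensor_pi reprK subrr.
have gB : zmod_morphism g.
  move=> s t; have [u ->] := tensor_pi_surj s; have [v ->] := tensor_pi_surj t.
  by rewrite -raddfB !gE /l raddfB.
pose gM := GRing.isZmodMorphism.Build tensor V g gB.
pose ga : {additive tensor -> V} := HB.pack g gM.
exists ga => x b.
by rewrite /= gE /l zliftU mulr1z.
Qed.

End UniversalProperty.

Lemma tensor_ext (V : zmodType) (g h : {additive tensor -> V}) :
  (forall x b, g (tens x b) = h (tens x b)) -> g =1 h.
Proof.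
move=> gh t; have [u ->] := tensor_pi_surj t.
apply: (zlift_uniq (g := g \o tensor_pi) (h := h \o tensor_pi)) => -[x b] /=.
exact: gh.
Qed.

End Tensor.

(* The homomorphism id_F (x) f, computed on a representative; by tensor_map_pi
   below, the choice of the representative is irrelevant. *)
Definition tensor_map (R : pzRingType) (F : lmodType R^c) (A B : lmodType R)
    (f : {linear A -> B}) (t : tensor F A) : tensor F B :=
  zlift (fun p : F * A => tens p.1 (f p.2)) (repr t).

Section TensorMap.
Variables (R : pzRingType) (F : lmodType R^c) (A B : lmodType R).
Variable f : {linear A -> B}.

Lemma tensor_map_pi u :
  tensor_map f (tensor_pi u) = zlift (fun p : F * A => tens p.1 (f p.2)) u.
Proof.
apply/eqP; rewrite -subr_eq0 -raddfB; apply/eqP.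
apply: (@tensor_rel_balanced R F A _ (fun x b => tens x (f b))).
- by move=> x y b; rewrite tensDl.
- by move=> x b c; rewrite raddfD tensDr.
- by move=> x a b; rewrite linearZ tensZ.
by apply/tensor_piP; rewrite raddfB /= /tensor_pi reprK subrr.
Qed.

Lemma tensor_mapE (x : F) (b : A) : tensor_map f (tens x b) = tens x (f b).
Proof. by rewrite tensor_map_pi zliftU mulr1z. Qed.

Fact tensor_map_is_zmod_morphism : zmod_morphism (@tensor_map R F A B f).
Proof.
move=> s t; have [u ->] := tensor_pi_surj s; have [v ->] := tensor_pi_surj t.
by rewrite -raddfB !tensor_map_pi raddfB.
Qed.

HB.instance Definition _ := GRing.isZmodMorphism.Build (tensor F A) (tensor F B)
  (@tensor_map R F A B f) tensor_map_is_zmod_morphism.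

End TensorMap.

Definition flat (R : pzRingType) (F : lmodType R^c) : Prop :=
  forall (A B : lmodType R) (f : {linear A -> B}),
    injective f -> injective (@tensor_map R F A B f).

Definition surj (A B : Type) (f : A -> B) : Prop := forall b, exists a, f a = b.

Definition exact_at (A B C : zmodType) (f : A -> B) (g : B -> C) : Prop :=
  forall b, g b = 0 <-> exists a, f a = b.

Definition projective (R : pzRingType) (P : lmodType R) : Prop :=
  forall (A B : lmodType R) (g : {linear A -> B}) (f : {linear P -> B}),
    surj g -> exists h : {linear P -> A}, forall x, g (h x) = f x.

Definition fin_gen (R : pzRingType) (A : lmodType R) : Prop :=
  exists (k : nat) (s : 'I_k -> A),
    forall x, exists c : 'I_k -> R, x = \sum_(i < k) c i *: s i.

Definition projective_resolution (R : pzRingType) (A : lmodType R)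
    (P : nat -> lmodType R) (d : forall i, {linear P i.+1 -> P i})
    (e : {linear P 0%N -> A}) : Prop :=
  [/\ forall i, projective (P i),
      surj e,
      exact_at (d 0%N) e &
      forall i, exact_at (d i.+1) (d i)].

(* Natural numbers extended with infinity, which is None; infinity - 1 is
   infinity. *)
Definition enat : Type := option nat.

Definition enat_le (i : nat) (n : enat) : Prop :=
  if n is Some m then (i <= m)%N else True.

Definition enat_pred (n : enat) : enat := omap predn n.

Definition module_FP (R : pzRingType) (A : lmodType R) (n : enat) : Prop :=
  exists (P : nat -> lmodType R) (d : forall i, {linear P i.+1 -> P i})
         (e : {linear P 0%N -> A}),
    projective_resolution d e /\ (forall i, enat_le i n -> fin_gen (P i)).

Definition trivial_module (M : monoidType) : lmodType (monring M) :=
  lres (@augmentation M).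

Definition left_FP (M : monoidType) (n : enat) : Prop :=
  module_FP (trivial_module M) n.

Definition monoid_pushout (W M1 M2 L : monoidType)
    (f1 : {monhom W -> M1}) (f2 : {monhom W -> M2})
    (i1 : {monhom M1 -> L}) (i2 : {monhom M2 -> L}) : Prop :=
  i1 \o f1 =1 i2 \o f2 /\
  forall (T : monoidType) (g1 : {monhom M1 -> T}) (g2 : {monhom M2 -> T}),
    g1 \o f1 =1 g2 \o f2 ->
    exists h : {monhom L -> T},
      [/\ h \o i1 =1 g1, h \o i2 =1 g2 &
          forall h' : {monhom L -> T},
            h' \o i1 =1 g1 -> h' \o i2 =1 g2 -> h' =1 h].

(* ZL with the right ZM-action x . m = x * f m; f need not be injective. *)
Definition right_monring (M L : monoidType) (f : {monhom M -> L}) :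
    lmodType (monring M)^c :=
  rres (monring_map f).

(* Main.v *)
(* Write T_M = ZL (x)_M Z for M = M1, M2, W. The sequence of left ZL-modules
     0 -> T_W -> T_M1 x T_M2 -> Z -> 0
   is exact for every pushout of monoids. Indeed, maps out of L into semidirect
   products V x| L encode derivations L -> V, so derivations on M1 and M2 that
   agree on W extend uniquely to L. Let eps generate T_W; the derivation
   D : L -> T_W with D m = m eps - eps on M1 and D m = 0 on M2 extends
   additively to ZL, and x |-> D x - x eps and x |-> D x then factor through
   T_M1 and T_M2, which yields an additive contraction of the sequence.
   By flatness, base change turns the given resolutions into resolutions of T_W
   and T_M1 x T_M2 with the same finiteness, and the mapping cone of a chain map
   lifting T_W -> T_M1 x T_M2 resolves Z; its term in degree i involves degree
   i - 1 of the resolution for W. *)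

Require Import Defs.
From HB Require Import structures.
From mathcomp Require Import all_boot all_algebra.
From mathcomp Require Import boolp.
From mathcomp Require Import monalg.

Set Implicit Arguments.
Unset Strict Implicit.
Unset Printing Implicit Defensive.

Import GRing.Theory.
Local Open Scope ring_scope.

(** * Linear images and products of modules *)

Section LinearImage.
Variables (R : pzRingType) (A B : lmodType R) (f : {linear A -> B}).

(** A boolean predicate, by classical reflection, so that the subtype it cuts out inherits the
    module structure of [B]. *)
Definition linear_image : {pred B} := fun b => `[< exists a, f a = b >].

Fact linear_image_submod : submod_closed linear_image.
Proof.
split=> [|k u v /asboolP[x <-] /asboolP[y <-]]; apply/asboolP.
  by exists 0; rewrite raddf0.
by exists (k *: x + y); rewrite linearP.
Qed.

HB.instance Definition _ :=
  GRing.isSubmodClosed.Build R B linear_image linear_image_submod.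

Definition image_module : Type := {b : B | linear_image b}.

HB.instance Definition _ := SubChoice.on image_module.
HB.instance Definition _ :=
  [SubChoice_isSubZmodule of image_module by <:].
HB.instance Definition _ :=
  [SubZmodule_isSubLmodule of image_module by <:].

End LinearImage.

Definition linear_pack (R : pzRingType) (A B : lmodType R) (f : A -> B)
    (fL : linear f) : {linear A -> B} :=
  HB.pack f (GRing.isLinear.Build R A B *:%R f fL).

Lemma linear_packE (R : pzRingType) (A B : lmodType R) (f : A -> B)
  (fL : linear f) : linear_pack fL =1 f.
Proof. by []. Qed.

Definition additive_pack (U V : zmodType) (f : U -> V)
    (fB : zmod_morphism f) : {additive U -> V} :=
  HB.pack f (GRing.isZmodMorphism.Build U V f fB).

Section ImageFactorization.
Variables (R : pzRingType) (A B : lmodType R) (f : {linear A -> B}).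

Lemma linear_corestrict (C : lmodType R) (g : {linear C -> B}) :
    (forall c, exists a, f a = g c) ->
  exists h : {linear C -> image_module f}, forall c, val (h c) = g c.
Proof.
move=> gf; have gfP c : linear_image f (g c) by apply/asboolP.
pose h c : image_module f := Sub (g c) (gfP c).
have hL : linear h.
  by move=> k u v; apply: val_inj; rewrite [RHS]linearP !SubK linearP.
by exists (linear_pack hL) => c; rewrite linear_packE SubK.
Qed.

Lemma image_factor :
  exists h : {linear A -> image_module f}, forall a, val (h a) = f a.
Proof. by apply: linear_corestrict => a; exists a. Qed.

End ImageFactorization.

(** Projectivity lifts along surjections; here [g] only has to reach the values of [f], so both maps
    are first corestricted to the image of [g]. *)
Lemma projective_lift (R : pzRingType) (P A B : lmodType R)
    (g : {linear A -> B}) (f : {linear P -> B}) :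
    projective P -> (forall x, exists a, g a = f x) ->
  exists h : {linear P -> A}, forall x, g (h x) = f x.
Proof.
move=> projP fg; have [f' f'E] := linear_corestrict fg.
have [g' g'E] := image_factor g.
have [] := projP _ _ g' f' => [[b gb]|h hE].
  have /asboolP[a ab] := gb.
  by exists a; apply: val_inj; rewrite g'E.
by exists h => x; rewrite -g'E hE f'E.
Qed.

Section Products.
Variables (R : pzRingType) (A B : lmodType R).

Lemma fin_gen_prod : fin_gen A -> fin_gen B -> fin_gen (A * B)%type.
Proof.
move=> [k [s sA]] [l [t tB]]; exists (k + l)%N.
exists (fun i => match split i with inl i => (s i, 0) | inr j => (0, t j) end).
move=> [a b]; have [c ->] := sA a; have [d ->] := tB b.
exists (fun i => match split i with inl i => c i | inr j => d j end).
rewrite big_split_ord /=.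
have splitl i : split (lshift l i) = inl i := unsplitK (inl i).
have splitr i : split (rshift k i) = inr i := unsplitK (inr i).
under [X in _ = X + _]eq_bigr do rewrite splitl.
under [X in _ = _ + X]eq_bigr do rewrite splitr.
rewrite [RHS]surjective_pairing !(raddfD fst, raddfD snd).
rewrite !(raddf_sum fst, raddf_sum snd) /=.
by rewrite [in X in (_ + X, _)]big1 ?[in X in (_, X + _)]big1 ?addr0 ?add0r //
  => i _; rewrite scaler0.
Qed.

Lemma projective_prod : projective A -> projective B -> projective (A * B)%type.
Proof.
move=> projA projB C D g f sg.
have inlL : linear (fun a : A => (a, 0 : B)).
  by move=> k u v; apply/pair_equal_spec; split; rewrite //= scaler0 addr0.
have inrL : linear (fun b : B => (0 : A, b)).
  by move=> k u v; apply/pair_equal_spec; split; rewrite //= scaler0 addr0.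
have [h hE] := projA _ _ g (f \o linear_pack inlL) sg.
have [j jE] := projB _ _ g (f \o linear_pack inrL) sg.
exists ((h \o fst) \+ (j \o snd)) => -[a b] /=.
rewrite raddfD /= hE jE /= -raddfD; congr (f _).
by apply/pair_equal_spec; split; rewrite /= ?addr0 ?add0r.
Qed.

End Products.

(** * Exactness of tensor products *)

(** Pure tensors generate the tensor product as an abelian group; integer coefficients are treated
    by induction, separately for each sign. *)
Lemma tensor_ind (R : pzRingType) (F : lmodType R^c) (A : lmodType R)
    (Q : tensor F A -> Prop) :
    Q 0 -> (forall s t, Q s -> Q t -> Q (s - t)) ->
    (forall x a, Q (tens x a)) ->
  forall t, Q t.
Proof.
move=> Q0 QB Qt t; have [u ->] := tensor_pi_surj t.
have QN s : Q s -> Q (- s) by rewrite -[- s]add0r; apply: QB.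
have QD s s' : Q s -> Q s' -> Q (s + s').
  by move=> Qs Qs'; rewrite -[s']opprK; apply: QB => //; apply: QN.
rewrite (monalgE u) raddf_sum; apply: big_ind => // -[x a] _.
rewrite malgZU raddfMz /= -/(tens x a); case: (_@__) => n;
  last rewrite NegzE mulrNz.
  elim: n => [|n IH]; [exact: Q0 | rewrite intS mulrzDr mulr1z; exact: QD].
apply: QN; elim: n => [|n IH]; first by rewrite mulr1z.
by rewrite intS mulrzDr mulr1z; apply: QD.
Qed.

Section TensorExact.
Variables (R : pzRingType) (F : lmodType R^c).

Lemma tensor_map_comp (A B C : lmodType R) (f : {linear A -> B})
    (g : {linear B -> C}) (k : {linear A -> C}) :
  (forall a, g (f a) = k a) ->
  forall t : tensor F A, tensor_map g (tensor_map f t) = tensor_map k t.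
Proof.
move=> gfk; pose T (M N : lmodType R) (h : {linear M -> N}) :=
  [the {additive tensor F M -> tensor F N} of @tensor_map R F M N h].
apply: (tensor_ext (g := T _ _ g \o T _ _ f) (h := T _ _ k)) => x a.
by rewrite /= !tensor_mapE gfk.
Qed.

Lemma tensor_map0 (A B : lmodType R) (f : {linear A -> B}) :
  (forall a, f a = 0) -> forall t : tensor F A, tensor_map f t = 0.
Proof.
move=> f0; apply: tensor_ind => [|s t s0 t0|x a]; rewrite ?raddf0 ?raddfB //.
  by rewrite /= s0 t0 subr0.
have tens0 : tens x (0 : B) = 0 :> tensor F B.
  by apply: (addrI (tens x 0)); rewrite -tensDr !addr0.
by rewrite tensor_mapE f0.
Qed.

Lemma tensor_map_surj (A B : lmodType R) (f : {linear A -> B}) :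
  surj f -> surj (@tensor_map R F A B f).
Proof.
move=> sf; apply: tensor_ind => [|s t [s' <-] [t' <-]|x b].
- by exists 0; rewrite raddf0.
- by exists (s' - t'); rewrite raddfB.
- by have [a <-] := sf b; exists (tens x a); rewrite tensor_mapE.
Qed.

(* Right exactness of the tensor product: a set-theoretic section of g induces
   a map F (x) C -> F (x) B, well defined modulo the image of F (x) A. *)
Lemma tensor_map_coker (A B C : lmodType R) (f : {linear A -> B})
    (g : {linear B -> C}) :
    surj g -> exact_at f g ->
  exact_at (@tensor_map R F A B f) (@tensor_map R F B C g).
Proof.
move=> sg fg t; split=> [|[s <-]]; last first.
  rewrite (tensor_map_comp (k := g \o f)) //.
  by apply: tensor_map0 => a /=; apply/fg; exists a.
pose im (v : tensor F B) := exists s : tensor F A, tensor_map f s = v.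
have im0 : im 0 by exists 0; rewrite raddf0.
have imB u v : im u -> im v -> im (u - v).
  by move=> [u' <-] [v' <-]; exists (u' - v'); rewrite raddfB.
have imT x b : g b = 0 -> im (tens x b).
  by move=> /fg[a <-]; exists (tens x a); rewrite tensor_mapE.
pose sec c := projT1 (cid (sg c)).
have gsec c : g (sec c) = c by rewrite /sec; case: cid.
pose lift : {additive _ -> _} := zlift (fun p : F * C => tens p.1 (sec p.2)).
have liftE x c : lift << (x, c) >> = tens x (sec c).
  by rewrite /lift /= zliftU mulr1z.
have tensB x b c : tens x (b - c) = tens x b - tens x c :> tensor F B.
  by apply/eqP; rewrite eq_sym subr_eq -tensDr subrK.
(* The section [sec] is not linear, but its defects are killed by [g] and hence come from [f]. *)
have lift_rel u : tensor_rel u -> im (lift u).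
  elim=> [|v w _ v0 _ w0|x y b|x b c|x a b]; rewrite ?raddf0 ?raddfB //=.
  - exact: imB.
  - by rewrite !liftE tensDl addrAC addrK subrr.
  - rewrite !liftE -!tensB; apply: imT.
    by rewrite !raddfB /= !gsec [b + c]addrC addrK subrr.
  - rewrite !liftE tensZ -tensB; apply: imT.
    by rewrite raddfB /= linearZ /= !gsec subrr.
(* Modulo the image of F (x) A, [t] is the lift of a representative of its own image. If that image
   is 0, the representative is a relation and its lift lies in the image of F (x) A too. *)
have lift_im : exists u, tensor_pi u = tensor_map g t /\ im (t - lift u).
  elim/tensor_ind: t => [|s t [u [uE ims]] [v [vE imt]]|x b].
  - by exists 0; rewrite (raddf0 lift) subr0 !raddf0.
  - exists (u - v); rewrite (raddfB lift) !raddfB /= uE vE; split=> //.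
    by rewrite addrACA -opprD; apply: imB.
  - exists << (x, g b) >>; rewrite tensor_mapE; split=> //.
    rewrite liftE -tensB; apply: imT.
    by rewrite raddfB /= gsec subrr.
move=> gt0; have [u [uE imt]] := lift_im.
have <- : (t - lift u) - (0 - lift u) = t by rewrite sub0r opprK subrK.
apply: (imB) => //; apply: imB => //; apply/lift_rel/tensor_piP.
by rewrite uE.
Qed.

(** Factor [g] through its image: right exactness handles the surjection onto the image, and
    flatness keeps the inclusion of the image into [C] injective. *)
Lemma tensor_map_exact (A B C : lmodType R) (f : {linear A -> B})
    (g : {linear B -> C}) :
    flat F -> exact_at f g ->
  exact_at (@tensor_map R F A B f) (@tensor_map R F B C g).
Proof.
move=> flatF fg t; have [g' g'E] := image_factor g.
have sg' : surj g'.
  move=> [c gc]; have /asboolP[b bc] := gc.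
  by exists b; apply: val_inj; rewrite g'E.
have fg' : exact_at f g'.
  move=> b; rewrite -fg -g'E; split=> [->|g'b0]; first by rewrite raddf0.
  by apply: val_inj; rewrite g'b0 raddf0.
pose v : {linear image_module g -> C} := val.
rewrite -(tensor_map_coker sg' fg') -(tensor_map_comp (f := g') (g := v)) //.
split=> [|->]; last by rewrite raddf0.
have vI : injective v by move=> x y /val_inj.
by move=> vt0; apply: (flatF _ _ _ vI); rewrite vt0 raddf0.
Qed.

End TensorExact.

(** * Base change *)

(** An alias of [V] that records [phi] in the type, so that the action of [R] can be inferred from
    it. *)
Definition restrict_scalars (R S : pzRingType) (phi : {rmorphism R -> S})
  (V : lmodType S) : Type := V.

Section RestrictionOfScalars.
Variables (R S : pzRingType) (phi : {rmorphism R -> S}) (V : lmodType S).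
Local Notation resV := (restrict_scalars phi V).

HB.instance Definition _ := GRing.Zmodule.on resV.

Definition restrict_scale (a : R) (v : resV) : resV := phi a *: (v : V).

Fact restrict_scaleA a b v :
  restrict_scale a (restrict_scale b v) = restrict_scale (a * b) v.
Proof. by rewrite /restrict_scale rmorphM scalerA. Qed.
Fact restrict_scale1 : left_id 1 restrict_scale.
Proof. by move=> v; rewrite /restrict_scale rmorph1 scale1r. Qed.
Fact restrict_scaleDr : right_distributive restrict_scale +%R.
Proof. by move=> a u v; rewrite /restrict_scale scalerDr. Qed.
Fact restrict_scaleDl v : {morph restrict_scale^~ v : a b / a + b}.
Proof. by move=> a b; rewrite /restrict_scale rmorphD scalerDl. Qed.

HB.instance Definition _ := GRing.Zmodule_isLmodule.Build R resV
  restrict_scaleA restrict_scale1 restrict_scaleDr restrict_scaleDl.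


End RestrictionOfScalars.

Section BaseChange.
Variables (R S : pzRingType) (phi : {rmorphism R -> S}).

Definition basechange (A : lmodType R) : Type := tensor (rres phi) A.

HB.instance Definition _ A := GRing.Zmodule.on (basechange A).

Definition btens (A : lmodType R) (s : S) (x : A) : basechange A :=
  tens (s : rres phi) x.

Section Module.
Variable A : lmodType R.
Implicit Types (s : S) (x : A) (t : basechange A).

Lemma btensDl s s' x : btens (s + s') x = btens s x + btens s' x.
Proof. exact: tensDl. Qed.
Lemma btensDr s x y : btens s (x + y) = btens s x + btens s y.
Proof. exact: tensDr. Qed.
Lemma btensZ s a x : btens (s * phi a) x = btens s (a *: x).
Proof. exact: (tensZ (s : rres phi)). Qed.

(** Left multiplication on [S] commutes with the right action of [R], hence descends to the tensor
    product. *)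
Fact basechange_scale_subproof s :
  exists g : {additive basechange A -> basechange A},
    forall s' x, g (btens s' x) = btens (s * s') x.
Proof.
apply: (tensor_universal (beta := fun s' : rres phi => btens (s * s'))) => *.
- by rewrite mulrDr btensDl.
- by rewrite btensDr.
- by rewrite -btensZ -mulrA.
Qed.

Definition basechange_scale s : {additive basechange A -> basechange A} :=
  projT1 (cid (basechange_scale_subproof s)).

Lemma basechange_scaleE s s' x :
  basechange_scale s (btens s' x) = btens (s * s') x.
Proof. by rewrite /basechange_scale; case: cid. Qed.

Fact basechange_scaleA s s' t :
  basechange_scale s (basechange_scale s' t) = basechange_scale (s * s') t.
Proof.
apply: (tensor_ext (g := basechange_scale s \o basechange_scale s')
                   (h := basechange_scale (s * s'))) => r x /=.
by rewrite !basechange_scaleE mulrA.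
Qed.
Fact basechange_scale1 : left_id 1 basechange_scale.
Proof.
apply: (tensor_ext (g := basechange_scale 1) (h := idfun)) => r x /=.
by rewrite basechange_scaleE mul1r.
Qed.
Fact basechange_scaleDr : right_distributive basechange_scale +%R.
Proof. by move=> s t t'; rewrite raddfD. Qed.
Fact basechange_scaleDl t : {morph basechange_scale^~ t : s s' / s + s'}.
Proof.
move=> s s'.
apply: (tensor_ext (g := basechange_scale (s + s'))
          (h := basechange_scale s \+ basechange_scale s')) => r x /=.
by rewrite !basechange_scaleE mulrDl btensDl.
Qed.

HB.instance Definition _ := GRing.Zmodule_isLmodule.Build S (basechange A)
  basechange_scaleA basechange_scale1 basechange_scaleDr basechange_scaleDl.

Lemma scale_btens s s' x : s *: btens s' x = btens (s * s') x.
Proof. exact: basechange_scaleE. Qed.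

Lemma btensE s x : btens s x = s *: btens 1 x.
Proof. by rewrite scale_btens mulr1. Qed.

Lemma basechange_ext (V : zmodType) (g h : {additive basechange A -> V}) :
  (forall s x, g (btens s x) = h (btens s x)) -> g =1 h.
Proof. exact: (tensor_ext (g := g) (h := h)). Qed.

(** One direction of the adjunction between base change and restriction of scalars, with
    semilinearity of [f] spelt out. *)
Lemma basechange_lift (V : lmodType S) (f : A -> V) :
    (forall x y, f (x + y) = f x + f y) ->
    (forall a x, f (a *: x) = phi a *: f x) ->
  exists g : {linear basechange A -> V}, forall s x, g (btens s x) = s *: f x.
Proof.
move=> fD fZ.
have [||s a x|g gE] := tensor_universal
    (F := rres phi) (beta := fun s x => (s : S) *: f x).
- by move=> s s' x; rewrite scalerDl.
- by move=> s x y; rewrite fD scalerDr.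
- by rewrite fZ scalerA.
have gL : linear (g : basechange A -> V).
  move=> s t t'; rewrite raddfD; congr (_ + _); move: t.
  apply: (basechange_ext (g := g \o basechange_scale s)
             (h := *:%R s \o (g : {additive basechange A -> V}))) => r x /=.
  by rewrite basechange_scaleE !gE scalerA.
by exists (linear_pack gL).
Qed.

End Module.

Lemma basechange_linear_ext (A : lmodType R) (V : lmodType S)
    (g h : {linear basechange A -> V}) :
  (forall x, g (btens 1 x) = h (btens 1 x)) -> g =1 h.
Proof.
move=> gh; apply: (basechange_ext (g := g) (h := h)) => s x.
by rewrite btensE [LHS]linearZ [RHS]linearZ gh.
Qed.

Section Map.
Variables (A B : lmodType R) (f : {linear A -> B}).

Definition basechange_map : basechange A -> basechange B :=
  @tensor_map R (rres phi) A B f.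

Lemma basechange_mapE s x : basechange_map (btens s x) = btens s (f x).
Proof. exact: tensor_mapE. Qed.

HB.instance Definition _ := GRing.Additive.on basechange_map.

Fact basechange_map_scalable : scalable basechange_map.
Proof.
move=> s t.
apply: (basechange_ext (g := basechange_map \o *:%R s)
          (h := *:%R s \o basechange_map)) => r x /=.
by rewrite scale_btens !basechange_mapE scale_btens.
Qed.

HB.instance Definition _ := GRing.isScalable.Build S
  (basechange A) (basechange B) *:%R basechange_map basechange_map_scalable.

End Map.

(** Base change is left adjoint to restriction of scalars, which preserves surjections: lift the
    restriction to [P], then extend. *)
Lemma basechange_projective (P : lmodType R) :
  projective P -> projective (basechange P).
Proof.
move=> projP V U g f sg.
have iotaL : linear (fun x : P => f (btens 1 x) : restrict_scalars phi U).
  move=> a x y; rewrite btensDr raddfD -btensZ mul1r btensE.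
  by congr (_ + _); exact: (linearZ_LR f (phi a) (btens 1 x)).
have gL : linear (g : restrict_scalars phi V -> restrict_scalars phi U).
  by move=> a; exact: (GRing.linearPZ g (phi a)).
have [h hE] := projP _ _ (linear_pack gL) (linear_pack iotaL) sg.
have [||k kE] := basechange_lift (V := V) (f := h).
- exact: raddfD.
- exact: (linearZ_LR h).
exists k.
apply: (basechange_linear_ext (g := g \o k)) => x /=.
by rewrite kE scale1r [LHS]hE.
Qed.

Lemma basechange_fin_gen (A : lmodType R) :
  fin_gen A -> fin_gen (basechange A).
Proof.
move=> [k [s sA]]; exists k, (fun i => btens 1 (s i)) => t.
elim/tensor_ind: t => [|t t' [c ->] [c' ->]|r x].
- by exists (fun=> 0); rewrite big1 // => i _; rewrite scale0r.
- exists (fun i => c i - c' i); rewrite -sumrB.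
  by apply: eq_bigr => i _; rewrite scalerBl.
have [c ->] := sA x; exists (fun i => r * phi (c i)).
pose T := btens r : A -> _.
have TB : zmod_morphism T.
  by move=> y z; apply/eqP; rewrite eq_sym subr_eq -btensDr subrK.
rewrite -[tens _ _]/(additive_pack TB _) raddf_sum; apply: eq_bigr => i _ /=.
by rewrite /T -btensZ btensE.
Qed.

(** The resolution is tensored term by term; flatness preserves its exactness. *)
Lemma basechange_FP (A : lmodType R) (n : enat) :
  flat (rres phi) -> module_FP A n -> module_FP (basechange A) n.
Proof.
move=> flatS [P [d [e [[projP se de dd] fgP]]]].
exists (fun i => basechange (P i)), (fun i => basechange_map (d i)).
exists (basechange_map e); split; last by move=> i /fgP/basechange_fin_gen.
split=> [i||| i].
- exact: basechange_projective.
- exact: tensor_map_surj.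
- exact: tensor_map_exact.
- exact: tensor_map_exact.
Qed.

End BaseChange.

(** * The mapping cone of a lifted chain map *)

Section PairMap.
Variables (R : pzRingType) (A A' B B' : lmodType R).
Variables (f : {linear A -> B}) (g : {linear A' -> B'}).

Definition pair_map (x : A * A') : B * B' := (f x.1, g x.2).

Fact pair_map_linear : linear pair_map.
Proof. by move=> a x y; apply/pair_equal_spec; split; rewrite /= linearP. Qed.

HB.instance Definition _ :=
  GRing.isLinear.Build R (A * A')%type (B * B')%type *:%R pair_map
    pair_map_linear.

End PairMap.

Lemma pair_map_exact (R : pzRingType) (A A' B B' C C' : lmodType R)
    (f : {linear A -> B}) (g : {linear B -> C})
    (f' : {linear A' -> B'}) (g' : {linear B' -> C'}) :
    exact_at f g -> exact_at f' g' ->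
  exact_at (pair_map f f') (pair_map g g').
Proof.
move=> fg fg' [b b']; split=> [[/fg[a <-] /fg'[a' <-]]|[[a a'] [<- <-]]].
  by exists (a, a').
by apply/pair_equal_spec; split; [apply/fg; exists a | apply/fg'; exists a'].
Qed.

Lemma module_FP_prod (R : pzRingType) (A B : lmodType R) (n : enat) :
  module_FP A n -> module_FP B n -> module_FP (A * B)%type n.
Proof.
move=> [P [d [e [[projP se de dd] fgP]]]] [Q [c [k [[projQ sk ck cc] fgQ]]]].
exists (fun i => (P i * Q i)%type), (fun i => pair_map (d i) (c i)).
exists (pair_map e k); split=> [|i lein]; last first.
  by apply: fin_gen_prod; [apply: fgP | apply: fgQ].
split=> [i|[a b]||i]; last 2 first; try exact: pair_map_exact.
  exact: projective_prod.
by have [x <-] := se a; have [y <-] := sk b; exists (x, y).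
Qed.

Section ConeBlock.
Variables (R : pzRingType) (T T' S S' : lmodType R).
Variables (d : {linear T' -> T}) (phi : {linear S' -> T}).
Variable c : {linear S' -> S}.

(** [cone_head] is the cone differential into degree 0, where the target has no S-part; [cone_block]
    is the one into higher degrees. The sign of [c] makes consecutive differentials compose to 0
    when [phi] is a chain map. *)
Definition cone_head (x : T' * S') : T := d x.1 + phi x.2.
Definition cone_block (x : T' * S') : T * S := (cone_head x, - c x.2).

Fact cone_head_linear : linear cone_head.
Proof.
by move=> a x y; rewrite /cone_head /= !linearP scalerDr addrACA.
Qed.

HB.instance Definition _ :=
  GRing.isLinear.Build R (T' * S')%type T *:%R cone_head cone_head_linear.

Fact cone_block_linear : linear cone_block.
Proof.
move=> a x y; apply/pair_equal_spec; split; rewrite /= linearP //.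
by rewrite opprD scalerN.
Qed.

HB.instance Definition _ :=
  GRing.isLinear.Build R (T' * S')%type (T * S)%type *:%R cone_block
    cone_block_linear.

End ConeBlock.

Section MappingCone.
Variables (R : pzRingType) (A B C : lmodType R) (n : enat).
Variables (a : {linear A -> B}) (b : {linear B -> C}).
Hypotheses (a_inj : injective a) (ab : exact_at a b) (sb : surj b).

Variables (S T : nat -> lmodType R).
Variables (c : forall i, {linear S i.+1 -> S i}) (k : {linear S 0 -> A}).
Variables (d : forall i, {linear T i.+1 -> T i}) (e : {linear T 0 -> B}).
Hypothesis resS : projective_resolution c k.
Hypothesis resT : projective_resolution d e.

(** The invariant of the recursion: it is exactly what lets [phi \o c i] lift along [d i]. *)
Definition lift_boundary i (phi : {linear S i -> T i}) : Prop :=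
  forall s, exists t, d i t = phi (c i s).

Lemma lift_start : exists phi : {linear S 0 -> T 0},
  lift_boundary phi /\ forall s, e (phi s) = a (k s).
Proof.
have [projS _ ck _] := resS; have [_ se de _] := resT.
have [|phi phiE] := @projective_lift R _ _ _ e (a \o k) (projS 0%N).
  by move=> s; apply: se.
exists phi; split=> // s; apply/de; rewrite phiE /=.
by rewrite (_ : k _ = 0) ?raddf0 //; apply/ck; exists s.
Qed.

Lemma lift_step i (phi : {linear S i -> T i}) : lift_boundary phi ->
  exists phi' : {linear S i.+1 -> T i.+1},
    lift_boundary phi' /\ forall s, d i (phi' s) = phi (c i s).
Proof.
have [projS _ _ cc] := resS; have [_ _ _ dd] := resT.
move=> bphi; have [|phi' phiE] :=
  @projective_lift R _ _ _ (d i) (phi \o c i) (projS i.+1).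
  by move=> s; have [t tE] := bphi s; exists t.
exists phi'; split=> // s; apply/dd; rewrite phiE /=.
by rewrite (_ : c i _ = 0) ?raddf0 //; apply/cc; exists s.
Qed.

(** The comparison theorem for resolutions. Each component is stored with its invariant because the
    choice of the next one depends on that proof. *)
Fixpoint chain_lift_sig i : {phi : {linear S i -> T i} | lift_boundary phi} :=
  match i with
  | 0 => let: exist phi p := cid lift_start in exist _ phi p.1
  | j.+1 =>
    let: exist phi p := chain_lift_sig j in
    let: exist phi' p' := cid (lift_step p) in exist _ phi' p'.1
  end.

Definition chain_lift i : {linear S i -> T i} := projT1 (chain_lift_sig i).

Lemma chain_lift0 s : e (chain_lift 0 s) = a (k s).
Proof. by rewrite /chain_lift /=; case: cid => phi []. Qed.

Lemma chain_liftS i s : d i (chain_lift i.+1 s) = chain_lift i (c i s).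
Proof.
by rewrite /chain_lift /=; case: (chain_lift_sig i) => phi p; case: cid => ? [].
Qed.

Definition cone i : lmodType R :=
  if i is j.+1 then (T j.+1 * S j)%type else T 0.

Definition cone_d i : {linear cone i.+1 -> cone i} :=
  match i with
  | 0 => cone_head (d 0) (chain_lift 0)
  | j.+1 => cone_block (d j.+1) (chain_lift j.+1) (c j)
  end.

Lemma cone_resolution :
  projective_resolution cone_d (b \o e : {linear cone 0 -> C}).
Proof.
have [projS sk ck cc] := resS; have [projT se de dd] := resT.
have de0 t : e (d 0 t) = 0 by apply/de; exists t.
have dd0 i t : d i (d i.+1 t) = 0 by apply/dd; exists t.
have ba0 x : b (a x) = 0 by apply/ab; exists x.
split=> [[|i]|z||[|i]].
- exact: projT.
- exact: projective_prod.
- by have [y <-] := sb z; have [x <-] := se y; exists x.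
(* Degree 0: by exactness at [B], e t = a x. Lifting [x] to [s] and subtracting [chain_lift 0 s]
   from [t] leaves an element of the kernel of [e]. *)
- move=> t; split=> /= [/ab[x xE]|[[t' s] <-]]; last first.
    by rewrite /cone_head /= raddfD /= de0 add0r chain_lift0 ba0.
  have [s sE] := sk x.
  have /de[t' t'E] : e (t - chain_lift 0 s) = 0.
    by rewrite raddfB /= chain_lift0 sE xE subrr.
  by exists (t', s); rewrite /cone_head /= t'E subrK.
- move=> [t s]; rewrite /= /cone_head /cone_block /cone_head /=.
  split=> [ts0|[[t' s'] [<- <-]]]; last first.
    by rewrite /= raddfD raddfN /= dd0 chain_liftS add0r subrr.
  (* Degree 1 is where injectivity of [a] enters: applying [e] to the vanishing cone head gives a (k
     s) = 0. *)
  have /ck[s' s'E] : k s = 0.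
    apply: a_inj; rewrite raddf0 -chain_lift0.
    by rewrite -[LHS]add0r -(de0 t) -raddfD /= ts0 raddf0.
  have /dd[t' t'E] : d 0 (t + chain_lift 1 s') = 0.
    by rewrite raddfD /= chain_liftS s'E.
  (* The sign of [s'] cancels the one in [cone_block]; [t'] absorbs the resulting chain map term. *)
  exists (t', - s') => /=; apply/pair_equal_spec.
  by rewrite !raddfN /= t'E addrK opprK.
move=> [t s]; rewrite /= /cone_block /cone_head /=.
split=> [|[[t' s'] [<- <-]]]; last first.
  rewrite /= raddfD !raddfN /= dd0 chain_liftS add0r subrr.
  by rewrite (_ : c i (c i.+1 s') = 0) ?oppr0 //; apply/cc; exists s'.
move=> [ts0 /eqP]; rewrite oppr_eq0 => /eqP/cc[s' s'E].
have /dd[t' t'E] : d i.+1 (t + chain_lift i.+2 s') = 0.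
  by rewrite raddfD /= chain_liftS s'E.
exists (t', - s') => /=; apply/pair_equal_spec.
by rewrite !raddfN /= t'E addrK opprK.
Qed.

End MappingCone.

Lemma module_FP_coker (R : pzRingType) (A B C : lmodType R) (n : enat)
    (a : {linear A -> B}) (b : {linear B -> C}) :
    injective a -> exact_at a b -> surj b ->
  module_FP A (enat_pred n) -> module_FP B n -> module_FP C n.
Proof.
move=> ia ab sb [S [c [k [resS fgS]]]] [T [d [e [resT fgT]]]].
exists (cone S T), (cone_d a resS resT), (b \o e).
split; first exact: cone_resolution.
case=> [|i] lein; first exact: fgT.
apply: fin_gen_prod; [exact: fgT | apply: fgS].
(* [S i] occurs in cone degree i + 1, so i + 1 <= n must yield i <= n - 1; for n = 0 the premise is
   absurd. *)
by case: n lein {fgT} => [[|m]|].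
Qed.

(** * Derivations and the modules T_M *)

Section SemidirectProduct.
Variables (L : monoidType) (V : lmodType (monring L)).

Definition semidirect : Type := (V * L)%type.

HB.instance Definition _ := Choice.on semidirect.

Definition semidirect_mul (x y : semidirect) : semidirect :=
  (mring x.2 *: y.1 + x.1, (x.2 * y.2)%g).

Fact semidirect_mulA : associative semidirect_mul.
Proof.
move=> x y z; apply/pair_equal_spec; split; last exact: mulgA.
by rewrite /= mringM -scalerA scalerDr addrA.
Qed.
Fact semidirect_mul1g : left_id (0, 1%g) semidirect_mul.
Proof.
case=> v l; apply/pair_equal_spec; split; last exact: mul1g.
by rewrite /= mring1 scale1r addr0.
Qed.
Fact semidirect_mulg1 : right_id (0, 1%g) semidirect_mul.
Proof.
case=> v l; apply/pair_equal_spec; split; last exact: mulg1.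
by rewrite /= scaler0 add0r.
Qed.

HB.instance Definition _ := isMonoid.Build semidirect
  semidirect_mulA semidirect_mul1g semidirect_mulg1.

Definition semidirect_proj (x : semidirect) : L := x.2.

Fact semidirect_projM : {morph semidirect_proj : x y / (x * y)%g}.
Proof. by []. Qed.
Fact semidirect_proj1 : semidirect_proj 1%g = 1%g. Proof. by []. Qed.

HB.instance Definition _ :=
  monoid.isMultiplicative.Build semidirect L semidirect_proj semidirect_projM.
HB.instance Definition _ :=
  Multiplicative_isUMagmaMorphism.Build semidirect L semidirect_proj
    semidirect_proj1.

Section Derivation.
Variables (M : monoidType) (g : {monhom M -> L}).

(** The Leibniz rule for the left action through [g] and the trivial right action, that is, a
    crossed homomorphism. *)
Definition derivation (D : M -> V) : Prop :=
  forall m m', D (m * m')%g = mring (g m) *: D m' + D m.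

Lemma derivation_monhom (D : M -> V) : derivation D ->
  exists h : {monhom M -> semidirect}, forall m, h m = (D m, g m).
Proof.
move=> derD; pose h m : semidirect := (D m, g m).
have hM : {morph h : x y / (x * y)%g}.
  by move=> x y; apply/pair_equal_spec; split; rewrite /= ?derD ?gmulfM.
have h1 : h 1%g = 1%g.
  apply/pair_equal_spec; split; last exact: gmulf1.
  (* The rule at 1 = 1 * 1 gives D 1 = D 1 + D 1. *)
  apply: (addrI (D 1%g)); rewrite addr0.
  by rewrite -{3}[1%g]mul1g derD gmulf1 mring1 scale1r.
pose hA := monoid.isMultiplicative.Build M semidirect h hM.
pose hB := Multiplicative_isUMagmaMorphism.Build M semidirect h h1.
pose hP : {monhom M -> semidirect} := HB.pack h hA hB.
by exists hP.
Qed.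

End Derivation.

End SemidirectProduct.

(** * Derivations on a pushout of monoids *)

Section PushoutDerivations.
Variables (W M1 M2 L : monoidType).
Variables (f1 : {monhom W -> M1}) (f2 : {monhom W -> M2}).
Variables (i1 : {monhom M1 -> L}) (i2 : {monhom M2 -> L}).
Hypothesis L_amalgam : monoid_pushout f1 f2 i1 i2.

Lemma pushout_hom_eq (T : monoidType) (h h' : {monhom L -> T}) :
  h \o i1 =1 h' \o i1 -> h \o i2 =1 h' \o i2 -> h =1 h'.
Proof.
move=> e1 e2; have [ii univ] := L_amalgam.
have [w|k [_ _ kU]] := univ T (h' \o i1) (h' \o i2).
  by have /= := ii w => ->.
by move=> l; rewrite (kU h e1 e2) (kU h').
Qed.

Variable V : lmodType (monring L).

Lemma pushout_derivation (D1 : M1 -> V) (D2 : M2 -> V) :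
    derivation i1 D1 -> derivation i2 D2 ->
    (forall w, D1 (f1 w) = D2 (f2 w)) ->
  exists D : L -> V,
    [/\ derivation idfun D, forall m, D (i1 m) = D1 m
      & forall m, D (i2 m) = D2 m].
Proof.
move=> /derivation_monhom[h1 h1E] /derivation_monhom[h2 h2E] DW.
have [ii univ] := L_amalgam.
have [w|h [hi1 hi2 _]] := univ _ h1 h2.
  by rewrite /= h1E h2E DW; have /= := ii w => ->.
(* The second component of [h] is an endomorphism of [L] that restricts to [i1] and [i2], hence the
   identity; so the first component is a derivation along the identity. *)
have h_proj l : (h l).2 = l.
  apply: (pushout_hom_eq (h := @semidirect_proj L V \o h) (h' := idfun)).
    by move=> m; have /= -> := hi1 m; rewrite h1E.
  by move=> m; have /= -> := hi2 m; rewrite h2E.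
exists (fun l => (h l).1); split=> [l l'|m|m].
- by rewrite gmulfM /= h_proj.
- by have /= -> := hi1 m; rewrite h1E.
- by have /= -> := hi2 m; rewrite h2E.
Qed.

Lemma pushout_derivation_eq (D D' : L -> V) :
    derivation idfun D -> derivation idfun D' ->
    (forall m, D (i1 m) = D' (i1 m)) -> (forall m, D (i2 m) = D' (i2 m)) ->
  D =1 D'.
Proof.
move=> /derivation_monhom[h hE] /derivation_monhom[h' hE'] e1 e2 l.
have hh : h =1 h'.
  by apply: pushout_hom_eq => m /=; rewrite hE hE' /= (e1, e2).
by have := hh l; rewrite hE hE' => -[].
Qed.

End PushoutDerivations.

Lemma linear_derivation (M L : monoidType) (g : {monhom M -> L})
    (V V' : lmodType (monring L)) (f : {linear V -> V'}) (D : M -> V) :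
  derivation g D -> derivation g (f \o D).
Proof. by move=> derD m m' /=; rewrite derD linearP. Qed.

Lemma inner_derivation (M L : monoidType) (g : {monhom M -> L})
    (V : lmodType (monring L)) (v : V) :
  derivation g (fun m => mring (g m) *: v - v).
Proof.
by move=> m m'; rewrite gmulfM mringM -scalerA scalerBr addrA subrK.
Qed.

Section DerivationExtension.
Variables (L : monoidType) (V : lmodType (monring L)) (D : L -> V).

(** The Leibniz rule is additive in its left factor, so that factor may range over ZL. *)
Lemma zlift_derivation (x : monring L) (l : L) : derivation idfun D ->
  zlift D (x * mring l) = x *: D l + zlift D x.
Proof.
move=> derD; have zB := raddfB (zlift D : {additive _ -> V}).
apply: (monring_ext (g := fun x => zlift D (x * mring l))
          (h := fun x => x *: D l + zlift D x)) => [u v|u v|m].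
- by rewrite mulrBl zB.
- by rewrite zB scalerBl opprD addrACA.
- by rewrite -mringM !zlift_mring derD.
Qed.

End DerivationExtension.

(* The properties of ZL (x)_M Z and its generator that the exact sequence needs;
   stated for an abstract module to keep unification away from the quotient
   defining the tensor product. *)
Record orbit_spec (M L : monoidType) (i : {monhom M -> L})
    (T : lmodType (monring L)) (e : T) : Prop := OrbitSpec {
  spec_fixed : forall m, mring (i m) *: e = e;
  spec_ext : forall (V : zmodType) (g h : T -> V),
    zmod_morphism g -> zmod_morphism h ->
    (forall l, g (mring l *: e) = h (mring l *: e)) -> g =1 h;
  spec_lift : forall (V : lmodType (monring L)) (v : V),
    (forall m, mring (i m) *: v = v) -> exists g : {linear T -> V}, g e = v;
  spec_additive : forall (V : zmodType) (theta : monring L -> V),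
    zmod_morphism theta -> (forall x m, theta (x * mring (i m)) = theta x) ->
    exists g : {additive T -> V}, forall x, g (x *: e) = theta x }.

(** * The modules ZL (x)_M Z and their generators *)

Section BasechangeTrivial.
Variables (M L : monoidType) (i : {monhom M -> L}).

(* The free abelian group on the L-set L (x)_M {pt}; when L is a group and M a
   subgroup this is Z[L/M]. *)
Definition orbit_module : Type :=
  basechange (monring_map i) (trivial_module M).

HB.instance Definition _ := GRing.Lmodule.on orbit_module.

Definition orbit_gen : orbit_module :=
  btens (monring_map i) 1 (1 : trivial_module M).

Lemma monring_map_mring m : monring_map i (mring m) = mring (i m).
Proof. exact: zlift_mring. Qed.

Lemma trivial_scale (m : M) (k : trivial_module M) : mring m *: k = k.
Proof.
rewrite -[LHS]/(augmentation (mring m) * (k : int)).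
by rewrite [augmentation _]zlift_mring mul1r.
Qed.

Lemma orbit_gen_fixed m : mring (i m) *: orbit_gen = orbit_gen.
Proof.
rewrite scale_btens mulr1 -[mring _]mul1r -monring_map_mring btensZ.
by rewrite trivial_scale.
Qed.

Lemma btens_orbit_gen (x : monring L) (k : int) :
  btens (monring_map i) x (k : trivial_module M) = (x *: orbit_gen) *~ k.
Proof.
pose T (k : int) : orbit_module :=
  btens (monring_map i) x (k : trivial_module M).
have TB : zmod_morphism T.
  by move=> u v; apply/eqP; rewrite eq_sym subr_eq -btensDr subrK.
by rewrite -[LHS]/(additive_pack TB k) -[k]intz raddfMz /= intz /T btensE.
Qed.

(** The translates of [orbit_gen] by elements of [L] generate the module as an abelian group. *)
Lemma orbit_ext (V : zmodType) (g h : orbit_module -> V) :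
    zmod_morphism g -> zmod_morphism h ->
  (forall l, g (mring l *: orbit_gen) = h (mring l *: orbit_gen)) -> g =1 h.
Proof.
move=> gB hB gh.
apply: (basechange_ext (g := additive_pack gB) (h := additive_pack hB)) => x k.
rewrite btens_orbit_gen !raddfMz /=; congr (_ *~ _).
apply: (monring_ext (g := fun x => g (x *: orbit_gen))
          (h := fun x => h (x *: orbit_gen))) => [y z|y z|l].
- by rewrite scalerBl gB.
- by rewrite scalerBl hB.
- exact: gh.
Qed.

(** A linear map out of the module amounts to a vector fixed by [M]. *)
Lemma orbit_lift (V : lmodType (monring L)) (v : V) :
    (forall m, mring (i m) *: v = v) ->
  exists g : {linear orbit_module -> V}, g orbit_gen = v.
Proof.
move=> vM; have [|a k|g gE] := basechange_lift (phi := monring_map i)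
    (A := trivial_module M) (V := V) (f := fun k => v *~ (k : int)).
- by move=> k l; rewrite mulrzDr.
- apply: (monring_ext (g := fun a => v *~ (a *: k : int))
            (h := fun a => monring_map i a *: (v *~ (k : int)))) => [x y|x y|m].
  + by rewrite scalerBl mulrzBr.
  + by rewrite raddfB scalerBl.
  + by rewrite trivial_scale monring_map_mring -scalerMzr vM.
by exists g; rewrite gE scale1r mulr1z.
Qed.

(** The counterpart of [orbit_lift] for additive maps, from which the contraction is built;
    invariance under right multiplication by [M] makes the pairing of [theta x] with integers
    balanced. *)
Lemma orbit_additive (V : zmodType) (theta : monring L -> V) :
    zmod_morphism theta ->
    (forall x m, theta (x * mring (i m)) = theta x) ->
  exists g : {additive orbit_module -> V},
    forall x, g (x *: orbit_gen) = theta x.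
Proof.
move=> thetaB thetaM.
have [|||g gE] := tensor_universal (R := monring M) (F := rres (monring_map i))
    (A := trivial_module M) (beta := fun x k => theta x *~ (k : int)).
- move=> x y k; rewrite -mulrzDl; congr (_ *~ _).
  exact: (raddfD (additive_pack thetaB)).
- by move=> x k l; rewrite mulrzDr.
- move=> x a k.
  apply: (monring_ext
            (g := fun a => theta (x * monring_map i a) *~ (k : int))
            (h := fun a => theta x *~ (a *: k : int))) => [y z|y z|m].
  + by rewrite raddfB mulrBr thetaB mulrzBl.
  + by rewrite scalerBl mulrzBr.
  + by rewrite trivial_scale monring_map_mring thetaM.
by exists g => x; rewrite scale_btens mulr1 [LHS]gE mulr1z.
Qed.

Lemma orbit_gen_spec : orbit_spec i orbit_gen.
Proof.
split; [exact: orbit_gen_fixed | exact: orbit_ext | exact: orbit_lift|].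
exact: orbit_additive.
Qed.

End BasechangeTrivial.

(** * The amalgam *)

Section AmalgamExactSequence.
Variables (W M1 M2 L : monoidType).
Variables (f1 : {monhom W -> M1}) (f2 : {monhom W -> M2}).
Variables (i1 : {monhom M1 -> L}) (i2 : {monhom M2 -> L}).
Hypothesis L_amalgam : monoid_pushout f1 f2 i1 i2.

Variables (T1 T2 TW : lmodType (monring L)) (e1 : T1) (e2 : T2) (eW : TW).
Hypotheses (spec1 : orbit_spec i1 e1) (spec2 : orbit_spec i2 e2).
Hypothesis specW : orbit_spec (i1 \o f1) eW.

(** The inner derivation of [eW] on [M1] and zero on [M2] agree on [W], since [W] fixes [eW]. *)
Lemma amalgam_derivation : exists D : L -> TW,
  [/\ derivation idfun D, forall m, D (i1 m) = mring (i1 m) *: eW - eW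
    & forall m, D (i2 m) = 0].
Proof.
apply: (pushout_derivation L_amalgam (D1 := fun m => mring (i1 m) *: eW - eW)
          (D2 := fun=> 0)).
- exact: inner_derivation.
- by move=> m m'; rewrite scaler0 addr0.
by move=> w; apply/eqP; rewrite subr_eq0; apply/eqP/(spec_fixed specW).
Qed.

(** Exactness concerns only the underlying groups, so an additive contraction suffices: s a = 1 and
    a s = 1 - j b, where j k = (0, k e2). *)
Lemma amalgam_exact :
  exists (a : {linear TW -> (T1 * T2)%type})
         (b : {linear (T1 * T2)%type -> trivial_module L}),
    [/\ injective a, exact_at a b & surj b].
Proof.
(* The sign makes b a = 0, as [b] adds the two augmentations. *)
have [w|a aE] := spec_lift specW (v := (e1, - e2) : (T1 * T2)%type).
  apply/pair_equal_spec; split; first exact: (spec_fixed spec1).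
  have /= e := L_amalgam.1 w.
  by rewrite /= e scalerN (spec_fixed spec2).
have triv (m : L) : mring m *: (1 : trivial_module L) = 1.
  exact: trivial_scale.
have [m|b1 b1E] := spec_lift spec1 (v := 1 : trivial_module L).
  exact: triv.
have [m|b2 b2E] := spec_lift spec2 (v := 1 : trivial_module L).
  exact: triv.
have b1l l : b1 (mring l *: e1) = 1 by rewrite linearZ_LR b1E triv.
have b2l l : b2 (mring l *: e2) = 1 by rewrite linearZ_LR b2E triv.
pose b := [the {linear _ -> _} of (b1 \o fst) \+ (b2 \o snd)] :
  {linear (T1 * T2)%type -> trivial_module L}.
have [D [derD D1 D2]] := amalgam_derivation.
have zDB : zmod_morphism (zlift D : monring L -> TW) by exact: raddfB.
(* Right multiplication by m in [M1] changes both D x and x eW by x (m eW - eW), so their difference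
   factors through [T1]. *)
have [||g1 g1E] := spec_additive spec1
    (theta := fun x => zlift D x - x *: eW).
- move=> x y; rewrite zDB scalerBl !opprB addrACA [RHS]addrACA.
  by rewrite [- _ - _]addrC.
- move=> x m; rewrite zlift_derivation // D1 scalerBr -scalerA.
  by rewrite addrC !addrA addNr add0r addrC.
(* As [D] vanishes on [M2], its additive extension factors through [T2] unchanged. *)
have [||g2 g2E] := spec_additive spec2
    (theta := zlift D : monring L -> TW).
- exact: zDB.
- by move=> x m; rewrite zlift_derivation // D2 scaler0 add0r.
have aDl l : a (mring l *: eW) = (mring l *: e1, - (mring l *: e2)).
  by rewrite linearZ_LR aE; apply/pair_equal_spec; split; rewrite //= scalerN.
(* [a \o D] is the inner derivation of [v0]: both are derivations on [L], and they agree on [M1] and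
   on [M2]. *)
pose v0 : (T1 * T2)%type := (0, - e2).
have aD l : a (D l) = (0, e2 - mring l *: e2).
  transitivity (mring l *: v0 - v0); last first.
    apply/pair_equal_spec; split; rewrite /= ?scaler0 ?subr0 //.
    by rewrite opprK scalerN addrC.
  apply: (pushout_derivation_eq L_amalgam (D := a \o D)
            (D' := fun l => mring l *: v0 - v0)) => [||m|m] /=.
  - exact: linear_derivation.
  - exact: inner_derivation.
  - rewrite D1 raddfB /= aDl aE; apply/pair_equal_spec; split=> /=.
      by rewrite (spec_fixed spec1) subrr scaler0 subr0.
    by rewrite scalerN.
  - rewrite D2 raddf0; apply/pair_equal_spec; split=> /=.
      by rewrite scaler0 subr0.
    by rewrite scalerN (spec_fixed spec2) subrr.
have g1l l : g1 (mring l *: e1) = D l - mring l *: eW.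
  by rewrite g1E zlift_mring.
have g2l l : g2 (mring l *: e2) = D l by rewrite g2E zlift_mring.
pose s (x : T1 * T2) : TW := - g1 x.1 - g2 x.2.
have sa : forall t, s (a t) = t.
  apply: (spec_ext specW) => [x y|//|l]; rewrite /s.
    by rewrite !raddfB /= -!opprD addrACA -opprD.
  by rewrite aDl /= raddfN /= g1l g2l opprK opprB subrK.
have ag1 : forall u, a (- g1 u) = (u, - (e2 *~ (b1 u : int))).
  apply: (spec_ext spec1) => [x y|x y|l].
  - by rewrite !(raddfB, raddfN) /=.
  - apply/pair_equal_spec; split; rewrite //= raddfB mulrzBr.
    by rewrite opprB opprK addrC.
  rewrite g1l b1l mulr1z opprB raddfB /= aDl aD.
  by apply/pair_equal_spec; split; rewrite /= ?subr0 // opprB addrA addNr sub0r.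
have ag2 : forall v, a (- g2 v) = (0, v - e2 *~ (b2 v : int)).
  apply: (spec_ext spec2) => [x y|x y|l].
  - by rewrite !(raddfB, raddfN) /=.
  - apply/pair_equal_spec; split; rewrite /= ?subr0 //.
    by rewrite raddfB mulrzBr opprD addrACA -opprD.
  rewrite g2l b2l mulr1z raddfN /= aD.
  by apply/pair_equal_spec; split; rewrite /= ?oppr0 // opprB.
(* Summing [ag1] and [ag2] gives the homotopy identity; on the kernel of [b] it shows x = a (s
   x). *)
have as_ x : a (s x) = x - (0, e2 *~ (b x : int)).
  rewrite /s raddfD /= ag1 ag2; case: x => u v.
  apply/pair_equal_spec; split; rewrite /= ?addr0 ?subr0 //.
  by rewrite mulrzDr opprD addrCA.
have ba t : b (a t) = 0.
  move: t; apply: (spec_ext specW) => [x y|x y|l]; rewrite ?raddfB ?subrr //.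
  by rewrite aDl /= raddfN /= b1l b2l subrr.
exists a, b; split=> [t t' att'|x|k].
- by rewrite -[t]sa att' sa.
- split=> [bx|[t <-]]; last exact: ba.
  exists (s x); rewrite as_ bx mulr0z.
  exact: subr0.
exists (e1 *~ (k : int), 0) => /=.
by rewrite raddf0 addr0 raddfMz /= b1E intz.
Qed.

End AmalgamExactSequence.

Theorem theorem4p10 (W M1 M2 L : monoidType)
  (f1 : {monhom W -> M1}) (f2 : {monhom W -> M2})
  (f1_inj : injective f1) (f2_inj : injective f2)
  (i1 : {monhom M1 -> L}) (i2 : {monhom M2 -> L})
  (L_amalgam : monoid_pushout f1 f2 i1 i2)
  (flat1 : flat (right_monring i1))
  (flat2 : flat (right_monring i2))
  (flatW : flat (right_monring (i1 \o f1)))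
  (n : enat) (n_ge1 : enat_le 1 n)
  (FP_M1 : left_FP M1 n) (FP_M2 : left_FP M2 n)
  (FP_W : left_FP W (enat_pred n)) :
  left_FP L n.
Proof.
(* The abstract modules become base changes of trivial modules, to which [basechange_FP] carries the
   finiteness assumptions. *)
have [a [b [ia ab sb]]] := amalgam_exact L_amalgam (orbit_gen_spec i1)
  (orbit_gen_spec i2) (orbit_gen_spec (i1 \o f1)).
apply: (module_FP_coker ia ab sb); first exact: basechange_FP.
by apply: module_FP_prod; apply: basechange_FP.
Qed.
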